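(* The node space complexity of each of the algorithms maxRPC3, lmaxRPC3, maxRPC3$^{rm}$ and lmaxRPC3$^{rm}$ is $O(ed)$. The branch space complexity of maxRPC3 and lmaxRPC3 is $O(end)$, while the branch space complexity of maxRPC3$^{rm}$ and lmaxRPC3$^{rm}$ is $O(ed)$. Here $n$ is the number of variables, $e$ the number of constraints and $d$ the maximum domain size of the binary CSP.
   Context: **Problem.** A binary CSP consists of variables $X=\{x_1,\dots,x_n\}$, finite domains $D(x_1),\dots,D(x_n)$ of size at most $d$, and a set $C$ of $e$ binary constraints; the constraint on $\{x_i,x_j\}$, if present, is denoted $c_{ij}$ (also $c_{ji}$) and specifies the allowed pairs of values. $D(x_i)$ always denotes the current domain; initial domains are totally ordered and iterated in this order. isConsistent$(a_i,a_j)$ tests whether $(a_i,a_j)$ is allowed by $c_{ij}$. An AC-support of $a_i$ in $D(x_j)$ is an $a_j\in D(x_j)$ such that $(a_i,a_j)$ satisfies $c_{ij}$. It is a PC-support if moreover for every third variable $x_k$ there is $a_k\in D(x_k)$ (a PC-witness) that is an AC-support of both $a_i$ and $a_j$. A value is maxRPC iff it has an AC-support, which is also a PC-support, in $D(x_j)$ for each constraint $c_{ij}$. **Complexity measures.** Space complexity refers to the space required for the data structures $LastPC$ and $LastAC$ below, including any copies kept for restoring them. The node space complexity is the worst-case space complexity of invoking the algorithm after a variable assignment (or stand-alone). The branch space complexity is the worst-case space complexity of any incremental sequence of $k\le n$ invocations, i.e. of incrementally running the algorithm down a branch of the search tree until a fail occurs. **Data structures.** For each constraint $c_{ij}$ and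 $a_i\in D(x_i)$ there are pointers $LastPC_{x_i,a_i,x_j}$ and $LastAC_{x_i,a_i,x_j}$ to the most recently discovered PC-support, resp. AC-support, of $a_i$ in $D(x_j)$; initially all are NIL, which precedes all values and belongs to no domain. In maxRPC3 and lmaxRPC3 these structures are maintained incrementally during search: they are copied when moving forward (after a successfully propagated variable assignment) and restored when backtracking (after a failed variable assignment). In maxRPC3$^{rm}$ and lmaxRPC3$^{rm}$ they are used as residues: simply kept, neither copied nor restored. ''$+1$'' denotes the next value. $L$ is a list (set) of variables. seekACsupport$(x_i,a_i,x_k)$ makes $LastAC_{x_i,a_i,x_k}$ point to the smallest AC-support of $a_i$ in the current $D(x_k)$ and returns true; it returns false if no AC-support exists. **Main loop** of maxRPC3 and maxRPC3$^{rm}$. Stand-alone, an initialization phase exhaustively checks each value, recording the supports found in the pointers, deletes values that are not maxRPC and puts their variables in $L$; after an assignment during search, $L$ contains the currently assigned variable. While $L\ne\emptyset$: remove some $x_j$ from $L$. For each $x_i$ with $c_{ij}\in C$ and each $a_i\in D(x_i)$: if searchPCsup$(a_i,x_j)$ is false, delete $a_i$ and add $x_i$ to $L$; otherwise, if checkPCwit$(a_i,x_j)$ is false, delete $a_i$ and add $x_i$ to $L$. If $D(x_i)$ becomes empty return FAILURE. When $L=\emptyset$ return SUCCESS. The light versions lmaxRPC3 and lmaxRPC3$^{rm}$ omit the call to checkPCwit. **searchPCsup$(a_i,x_j)$.** If $LastPC_{x_i,a_i,x_j}\in D(x_j)$ return true. Otherwise let $b_j$ be: for (l)maxRPC3, $\max(LastPC_{x_i,a_i,x_j}+1,LastAC_{x_i,a_i,x_j})$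 if $LastAC_{x_i,a_i,x_j}\in D(x_j)$ and $\max(LastPC_{x_i,a_i,x_j}+1,LastAC_{x_i,a_i,x_j}+1)$ otherwise; for (l)maxRPC3$^{rm}$, the first value of $D(x_j)$. For each $a_j\in D(x_j)$, $a_j\ge b_j$, with isConsistent$(a_i,a_j)$: (for (l)maxRPC3 only) if $LastAC_{x_i,a_i,x_j}\notin D(x_j)$ and $LastAC_{x_i,a_i,x_j}>LastPC_{x_i,a_i,x_j}$, set $LastAC_{x_i,a_i,x_j}=a_j$; if searchPCwit$(a_i,a_j)$, set $LastPC_{x_i,a_i,x_j}=a_j$, (for the $rm$ versions only) also $LastAC_{x_i,a_i,x_j}=a_j$ and $LastPC_{x_j,a_j,x_i}=a_i$, and return true. Return false. **searchPCwit$(a_i,a_j)$.** For each $x_k$ with $c_{ik},c_{jk}\in C$: if $LastAC_{x_i,a_i,x_k}$ is in $D(x_k)$ and consistent with $a_j$, or $LastAC_{x_j,a_j,x_k}$ is in $D(x_k)$ and consistent with $a_i$, continue with the next $x_k$. Otherwise: for (l)maxRPC3, return false if seekACsupport$(x_i,a_i,x_k)$ or seekACsupport$(x_j,a_j,x_k)$ is false, and let $b_k=\max(LastAC_{x_i,a_i,x_k},LastAC_{x_j,a_j,x_k})$; for the $rm$ versions let $b_k$ be the first value of $D(x_k)$. Search for $a_k\in D(x_k)$, $a_k\ge b_k$, consistent with both $a_i$ and $a_j$; if found, the $rm$ versions set $LastAC_{x_i,a_i,x_k}=LastAC_{x_j,a_j,x_k}=a_k$; if not found return false. Return true after all $x_k$.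 **checkPCwit$(a_i,x_j)$.** For each $x_k$ with $c_{ik},c_{kj}\in C$: if $a_k:=LastPC_{x_i,a_i,x_k}\in D(x_k)$, look for a PC-witness of $(a_i,a_k)$ in $D(x_j)$ exactly as searchPCwit$(a_i,a_k)$ does for the single third variable $x_j$. If $LastPC_{x_i,a_i,x_k}\notin D(x_k)$ or no PC-witness is found, search for a new PC-support of $a_i$ in $D(x_k)$ exactly as the search phase of searchPCsup$(a_i,x_k)$ does (starting value, pointer updates and calls to searchPCwit included); if none is found return false. Return true after all $x_k$. *)

(* Defs.v *)
From mathcomp Require Import all_boot finmap.

Set Implicit Arguments.
Unset Strict Implicit.
Unset Printing Implicit Defensive.

Local Open Scope fset_scope.
Local Open Scope fmap_scope.

(* The variables are 'I_nvar.  A constraint is identified with its scope {i, j}.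
   [dom0 i] lists the initial domain of i in increasing order. *)
Record csp := Csp {
  nvar : nat;
  value : choiceType;
  scopes : {set {set 'I_nvar}};
  scopes_binary : forall c, c \in scopes -> #|c| = 2;
  allows : 'I_nvar -> value -> 'I_nvar -> value -> bool;
  allowsC : forall i j a b,
    [set i; j]%SET \in scopes -> allows i a j b = allows j b i a;
  dom0 : 'I_nvar -> seq value;
  dom0_uniq : forall i, uniq (dom0 i)
}.

Definition ncon (P : csp) : nat := #|scopes P|.
Definition maxdom (P : csp) : nat := \max_(i < nvar P) size (dom0 i).

Inductive algo := maxRPC3 | lmaxRPC3 | maxRPC3rm | lmaxRPC3rm.

Definition is_rm (A : algo) : bool :=
  match A with maxRPC3rm | lmaxRPC3rm => true | _ => false end.
Definition is_light (A : algo) : bool :=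
  match A with lmaxRPC3 | lmaxRPC3rm => true | _ => false end.

(* Loops with early exit: [allM] stops at the first [false], [hasM] at the
   first [true]. *)
Fixpoint allM (S T : Type) (f : T -> S -> bool * S) (l : seq T) (s : S) :
    bool * S :=
  if l is x :: l' then
    let: (b, s') := f x s in if b then allM f l' s' else (false, s')
  else (true, s).

Fixpoint hasM (S T : Type) (f : T -> S -> bool * S) (l : seq T) (s : S) :
    bool * S :=
  if l is x :: l' then
    let: (b, s') := f x s in if b then (true, s') else hasM f l' s'
  else (false, s).

Section Algorithms.
Context (P : csp).

Notation var := 'I_(nvar P).
Notation val := (value P).

Definition con (i j : var) : bool := [set i; j]%SET \in scopes P.

(* A structure maps the allocated addresses (i, a, j) to pointers; the pointer
   NIL is [None].  A write at an address outside the domain allocates a cell. *)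
Definition address := (var * val * var)%type.
Definition store := {fmap address -> option val}.

Definition addresses : seq address :=
  flatten [seq [seq (p.1, a, p.2) | a <- dom0 p.1]
          | p <- enum [set p : var * var | con p.1 p.2]].

Definition nil_store : store := [fmap k : [fset k in addresses] => None].

Definition domains := {ffun var -> seq val}.

(* One frame per search node on the current branch: its domains, its assigned
   variables and, when the structures have to be restored, the copies of
   (LastPC, LastAC). *)
Record frame := Frame {
  fdom : domains;
  fassigned : {set var};
  fcopy : option (store * store)
}.

(* [peak] is the high-water mark of [space] since the last [reset_peak]. *)
Record state := State {
  dom : domains;
  lastPC : store;
  lastAC : store;
  frames : seq frame;
  peak : nat
}.

(* Number of pointers held by the live structures and by all saved copies. *)
Definition store_size (m : store) : nat := #|` domf m|.
Definition frame_size (f : frame) : nat :=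
  if fcopy f is Some (pc, ac) then store_size pc + store_size ac else 0.
Definition space (s : state) : nat :=
  store_size (lastPC s) + store_size (lastAC s)
  + \sum_(f <- frames s) frame_size f.

Definition touch (s : state) : state :=
  State (dom s) (lastPC s) (lastAC s) (frames s) (maxn (peak s) (space s)).
Definition reset_peak (s : state) : state :=
  State (dom s) (lastPC s) (lastAC s) (frames s) (space s).

Definition getPC (s : state) (i : var) (a : val) (j : var) : option val :=
  odflt None (lastPC s).[? (i, a, j)].
Definition getAC (s : state) (i : var) (a : val) (j : var) : option val :=
  odflt None (lastAC s).[? (i, a, j)].
Definition setPC (i : var) (a : val) (j : var) (b : val) (s : state) : state :=
  touch (State (dom s) (lastPC s).[(i, a, j) <- Some b] (lastAC s)
               (frames s) (peak s)).
Definition setAC (i : var) (a : val) (j : var) (b : val) (s : state) : state :=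
  touch (State (dom s) (lastPC s) (lastAC s).[(i, a, j) <- Some b]
               (frames s) (peak s)).
Definition set_dom (i : var) (D : seq val) (s : state) : state :=
  State [ffun k => if k == i then D else dom s k]
        (lastPC s) (lastAC s) (frames s) (peak s).
Definition delete (i : var) (a : val) (s : state) : state :=
  set_dom i [seq b <- dom s i | b != a] s.

(* Position in the ordered initial domain: NIL has rank 0, the first value
   rank 1, and the "next value" of p has rank (rank p).+1. *)
Definition rank (j : var) (p : option val) : nat :=
  if p is Some a then (index a (dom0 j)).+1 else 0.

Definition in_dom (s : state) (j : var) (p : option val) : bool :=
  if p is Some b then b \in dom s j else false.

Definition seekACsupport (i : var) (a : val) (k : var) (s : state) :
    bool * state :=
  if [seq b <- dom s k | allows i a k b] is b :: _
  then (true, setAC i a k b s) else (false, s).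

(* The part of searchPCwit(a, b) that concerns the third variable k. *)
Definition witness_in (A : algo) (i : var) (a : val) (j : var) (b : val)
    (k : var) (s : state) : bool * state :=
  let ok p l c := if p is Some w then (w \in dom s k) && allows l c k w
                  else false in
  if ok (getAC s i a k) j b || ok (getAC s j b k) i a then (true, s) else
  let: (start, s1) :=
    if is_rm A then (Some 0, s) else
    let: (ok_i, si) := seekACsupport i a k s in
    if ~~ ok_i then (None, si) else
    let: (ok_j, sj) := seekACsupport j b k si in
    if ~~ ok_j then (None, sj) else
    (Some (maxn (rank k (getAC sj i a k)) (rank k (getAC sj j b k))), sj) in
  if start is Some bk then
    if [seq w <- dom s1 k |
         [&& bk <= rank k (Some w), allows i a k w & allows j b k w]]
    is w :: _
    then (true, if is_rm A then setAC j b k w (setAC i a k w s1) else s1)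
    else (false, s1)
  else (false, s1).

Definition searchPCwit (A : algo) (i : var) (a : val) (j : var) (b : val)
    (s : state) : bool * state :=
  allM (witness_in A i a j b) [seq k <- enum 'I_(nvar P) | con i k && con j k] s.

(* The loop body of searchPCsup for the candidate b.  In the initialization
   phase ([init]) there is no earlier LastPC to compare with, and the first
   AC-support met is recorded. *)
Definition try_value (A : algo) (init : bool) (i : var) (a : val) (j : var)
    (b : val) (s : state) : bool * state :=
  if ~~ allows i a j b then (false, s) else
  let ac := getAC s i a j in
  let record_ac :=
    ~~ in_dom s j ac &&
    (init || ~~ is_rm A && (rank j (getPC s i a j) < rank j ac)) in
  let: (found, s1) :=
    searchPCwit A i a j b (if record_ac then setAC i a j b s else s) in
  if ~~ found then (false, s1) else
  let s2 := setPC i a j b s1 in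
  (true, if is_rm A then setPC j b i a (setAC i a j b s2) else s2).

Definition start_rank (A : algo) (i : var) (a : val) (j : var) (s : state) :
    nat :=
  let pc := rank j (getPC s i a j) in
  let ac := rank j (getAC s i a j) in
  if is_rm A then 0
  else maxn pc.+1 (if in_dom s j (getAC s i a j) then ac else ac.+1).

Definition search_phase (A : algo) (i : var) (a : val) (j : var) (s : state) :
    bool * state :=
  hasM (try_value A false i a j)
       [seq b <- dom s j | start_rank A i a j s <= rank j (Some b)] s.

Definition searchPCsup (A : algo) (i : var) (a : val) (j : var) (s : state) :
    bool * state :=
  if in_dom s j (getPC s i a j) then (true, s) else search_phase A i a j s.

Definition checkPCwit (A : algo) (i : var) (a : val) (j : var) (s : state) :
    bool * state :=
  allM (fun k s =>
          let: (ok, s1) :=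
            if getPC s i a k is Some c then
              if c \in dom s k then witness_in A i a k c j s else (false, s)
            else (false, s) in
          if ok then (true, s1) else search_phase A i a k s1)
       [seq k <- enum 'I_(nvar P) | con i k && con k j] s.

Definition revise (A : algo) (j i : var) (Ls : {set var} * state) (a : val) :
    {set var} * state :=
  let: (L, s) := Ls in
  let: (ok, s1) := searchPCsup A i a j s in
  let: (keep, s2) :=
    if ok && ~~ is_light A then checkPCwit A i a j s1 else (ok, s1) in
  if keep then (L, s2) else ((i |: L)%SET, delete i a s2).

(* The work done for a variable j removed from L; [false] is FAILURE. *)
Definition process (A : algo) (j : var) (L : {set var}) (s : state) :
    bool * ({set var} * state) :=
  allM (fun i (Ls : {set var} * state) =>
          let Ls' := foldl (revise A j i) Ls (dom Ls.2 i) in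
          (dom Ls'.2 i != [::], Ls'))
       [seq i <- enum 'I_(nvar P) | con i j] (L, s).

Definition init_value (A : algo) (i : var) (Ls : {set var} * state) (a : val) :
    {set var} * state :=
  let: (L, s) := Ls in
  let: (keep, s1) :=
    allM (fun j s => hasM (try_value A true i a j) (dom s j) s)
         [seq j <- enum 'I_(nvar P) | con i j] s in
  if keep then (L, s1) else ((i |: L)%SET, delete i a s1).

Definition initialization (A : algo) (s : state) :
    bool * ({set var} * state) :=
  allM (fun i (Ls : {set var} * state) =>
          let Ls' := foldl (init_value A i) Ls (dom Ls.2 i) in
          (dom Ls'.2 i != [::], Ls'))
       (enum 'I_(nvar P)) (set0, s).

(* [RUNNING]: the execution has not terminated yet. *)
Inductive outcome := RUNNING | SUCCESS | FAILURE.

(* The choice of the variable removed from L is left open. *)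
Inductive loop (A : algo) : {set var} -> state -> outcome -> state -> Prop :=
| LoopRunning L s : loop A L s RUNNING s
| LoopSuccess s : loop A set0 s SUCCESS s
| LoopFailure (L : {set var}) s j L' s' :
    j \in L -> process A j (L :\ j)%SET s = (false, (L', s')) ->
    loop A L s FAILURE s'
| LoopStep (L : {set var}) s j L' s' o s'' :
    j \in L -> process A j (L :\ j)%SET s = (true, (L', s')) ->
    loop A L' s' o s'' -> loop A L s o s''.

Inductive invocation := StandAlone | Assign of var & val.

Inductive invoke (A : algo) (s : state) : invocation -> outcome -> state -> Prop :=
| InvokeInitFailure L s' :
    initialization A s = (false, (L, s')) -> invoke A s StandAlone FAILURE s'
| InvokeStandAlone L s' o s'' :
    initialization A s = (true, (L, s')) -> loop A L s' o s'' ->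
    invoke A s StandAlone o s''
| InvokeAssign x a o s' :
    loop A [set x]%SET (set_dom x [:: a] s) o s' ->
    invoke A s (Assign x a) o s'.

(* Moving forward to a new search node with assigned variables X.  The root
   node also gets a copy: a failed first assignment has to be undone. *)
Definition enter (A : algo) (X : {set var}) (s : state) : state :=
  let copy := if is_rm A then None else Some (lastPC s, lastAC s) in
  touch (State (dom s) (lastPC s) (lastAC s)
               (Frame (dom s) X copy :: frames s) (peak s)).

(* Back to the node of the top frame. *)
Definition restore (s : state) : state :=
  if frames s is f :: _ then
    let: (pc, ac) := odflt (lastPC s, lastAC s) (fcopy f) in
    State (fdom f) pc ac (frames s) (peak s)
  else s.

Definition pop (s : state) : state :=
  State (dom s) (lastPC s) (lastAC s) (behead (frames s)) (peak s).

Definition initial : state :=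
  reset_peak (State [ffun i => dom0 i] nil_store nil_store [::] 0).

Inductive forward (A : algo) (s : state) : invocation -> outcome -> state -> Prop :=
| ForwardStandAlone o s' :
    frames s = [::] -> invoke A s StandAlone o s' ->
    forward A s StandAlone o (if o is SUCCESS then enter A set0 s' else s')
| ForwardAssign f fs x a o s' :
    frames s = f :: fs -> x \notin fassigned f -> a \in dom s x ->
    invoke A s (Assign x a) o s' ->
    forward A s (Assign x a) o
      (if o is SUCCESS then enter A (x |: fassigned f)%SET s' else s').

(* The states, between two invocations, of a backtracking search; it may start
   with or without a stand-alone invocation. *)
Inductive search (A : algo) : state -> Prop :=
| SearchInitial : search A initial
| SearchRoot : search A (enter A set0 initial)
| SearchForward s v s' :
    search A s -> forward A s v SUCCESS s' -> search A s'
| SearchFail s x a s' :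
    search A s -> forward A s (Assign x a) FAILURE s' -> search A (restore s')
| SearchBacktrack s :
    search A s -> 1 < size (frames s) -> search A (restore (pop s)).

(* [branch A k s s']: k successive invocations from s lead to s'; the last one
   may have failed or may still be running. *)
Inductive branch (A : algo) : nat -> state -> state -> Prop :=
| BranchNil s : branch A 0 s s
| BranchLast s v o s' : forward A s v o s' -> branch A 1 s s'
| BranchStep s v s' k s'' :
    forward A s v SUCCESS s' -> branch A k s' s'' -> branch A k.+1 s s''.

(* A single invocation is charged for the live structures, for the copy to be
   restored if it fails and for the copy made if it succeeds; the copies that
   belong to earlier nodes of the branch are dropped. *)
Definition node_state (s : state) : state :=
  reset_peak (State (dom s) (lastPC s) (lastAC s) (take 1 (frames s)) (peak s)).

Definition node_space (A : algo) (m : nat) : Prop :=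
  exists s v o s',
    [/\ search A s, forward A (node_state s) v o s' & m = peak s'].

(* Branches start at the root, where earlier search may have left residues. *)
Definition branch_space (A : algo) (m : nat) : Prop :=
  exists s k s',
    [/\ search A s, size (frames s) <= 1, k <= nvar P,
        branch A k (reset_peak s) s' & m = peak s'].

End Algorithms.

(* [use P m]: some execution on P reaches the space usage m. *)
Definition worst_case_le (use : csp -> nat -> Prop) (n e d bound : nat) : Prop :=
  forall P : csp, nvar P = n -> ncon P = e -> maxdom P = d ->
  forall m, use P m -> m <= bound.

Definition space_O (use : csp -> nat -> Prop) (f : nat -> nat -> nat -> nat) :
    Prop :=
  exists c, forall n e d, worst_case_le use n e d (c * f n e d).

(* Main.v *)
Require Import Defs.
From mathcomp Require Import all_boot finmap.

(** Every write goes to an address (x_i, a_i, x_j) with a constraint on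
    {x_i, x_j} and a_i in the initial domain of x_i, hence to one of the O(ed)
    cells allocated at the start, so a pair (LastPC, LastAC) never outgrows
    its initial size.  The versions that restore the structures keep one extra
    copy of the pair per frame: at most two for a single invocation and n + 1
    along a branch; the residue versions keep none. *)

Set Implicit Arguments.
Unset Strict Implicit.
Unset Printing Implicit Defensive.

Local Open Scope fset_scope.

Section SpaceInvariant.
Context (P : csp) (A : algo).

Notation var := 'I_(nvar P).
Notation val := (value P).
Notation cells := [fset x in addresses P].
Notation mem0 i a := (a \in @dom0 P i).

(** * Counting the pointer cells *)

Lemma con_sym (i j : var) : con i j = con j i.
Proof. by rewrite /con setUC. Qed.

Lemma mem_addresses (i : var) (a : val) (j : var) :
  con i j -> mem0 i a -> (i, a, j) \in addresses P.
Proof.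
move=> cij ai; apply/flatten_mapP; exists (i, j); first by rewrite mem_enum inE.
by apply/mapP; exists a.
Qed.

(** A constrained ordered pair lies in the square [c * c] of its scope [c], and such a square has 4
    elements. Covering by whole squares gives 4 rather than the exact 2, but needs no listing of the
    pairs of a scope. *)
Lemma card_con : #|[set p : var * var | con p.1 p.2]%SET| <= 4 * ncon P.
Proof.
have sub : ([set p : var * var | con p.1 p.2] \subset
            \bigcup_(c in scopes P) setX c c)%SET.
  apply/subsetP => -[i j]; rewrite inE => cij.
  by apply/bigcupP; exists [set i; j]%SET; rewrite // !inE !eqxx orbT.
apply: leq_trans (subset_leq_card sub) _.
rewrite /ncon mulnC -sum_nat_const.
elim/big_rec2: _ => [|c n U cP leUn]; first by rewrite cards0.
apply: leq_trans (leq_card_setU _ _) _.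
by rewrite leq_add // cardsX scopes_binary.
Qed.

Lemma card_cells : #|` cells| <= 4 * (ncon P * maxdom P).
Proof.
rewrite card_fseq; apply: leq_trans (size_undup _) _.
rewrite /addresses size_flatten /shape -map_comp sumnE big_map.
apply: leq_trans (_ : \sum_(p <- enum [set p : var * var | con p.1 p.2]%SET)
                        maxdom P <= _).
  apply: leq_sum => -[i j] _ /=; rewrite size_map.
  exact: (leq_bigmax (F := fun i : var => size (dom0 i)) i).
rewrite big_const_seq count_predT iter_addn_0 mulnC mulnA leq_mul2r -cardE.
by rewrite card_con orbT.
Qed.

(** Later absorbs the additive constant in n + 2 into a multiple of n. *)
Lemma ncon_gt0_nvar : 0 < ncon P -> 1 < nvar P.
Proof.
case/card_gt0P => c cP; rewrite -(card_ord (nvar P)).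
by rewrite -(scopes_binary cP) max_card.
Qed.

(** * The invariant and the space it allows *)

Definition subdom (D : domains P) : bool :=
  [forall i : var, all (fun a => mem0 i a) (D i)].

(** What [restore] needs in order to reinstate a frame. A copy is allowed only in the restoring
    versions, so frames cost nothing in the residue versions. *)
Definition frame_sound (f : frame P) : bool :=
  subdom (fdom f) &&
  (if fcopy f is Some (pc, ac)
   then [&& ~~ is_rm A, domf pc `<=` cells & domf ac `<=` cells] else true).

(** The factor 2 stands for the pair (LastPC, LastAC); [k.+1] counts the live pair and one copy for
    each of [k] frames. *)
Definition capacity (k : nat) : nat :=
  2 * #|` cells| * (if is_rm A then 1 else k.+1).

(** The peak is part of the invariant because it also records the space of intermediate states. *)
Definition inv (k : nat) (s : state P) : bool :=
  [&& [&& subdom (dom s), domf (lastPC s) `<=` cells,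
          domf (lastAC s) `<=` cells, all frame_sound (frames s)
        & size (frames s) <= k]
    & peak s <= capacity k].

Lemma leq_capacity k l : k <= l -> capacity k <= capacity l.
Proof.
by move=> kl; rewrite leq_mul2l orbC; case: is_rm; rewrite ?leqnn ?ltnS ?kl.
Qed.

Lemma invW k l s : k <= l -> inv k s -> inv l s.
Proof.
move=> kl /andP[/and5P[? ? ? ? /leq_trans lek] /leq_trans lep].
by apply/andP; split; [apply/and5P; split => //; exact: lek
                      | exact: lep (leq_capacity kl)].
Qed.

Lemma inv_dom k s (i : var) : inv k s -> {subset dom s i <= dom0 i}.
Proof. by case/andP => /and5P[/forallP/(_ i)/allP]. Qed.

(** Follows from the conjuncts on stores and frames alone, whatever the peak; this is what lets a
    new peak be bounded. *)
Lemma space_le k s : inv k s -> space s <= capacity k.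
Proof.
case/andP => /and5P[_ pc ac fs szk] _.
apply: leq_trans (_ : capacity (size (frames s)) <= _); last exact: leq_capacity.
rewrite /space /capacity.
have live : store_size (lastPC s) + store_size (lastAC s) <= 2 * #|` cells|.
  by rewrite mul2n -addnn leq_add // fsubset_leq_card.
have saved : \sum_(f <- frames s) frame_size f <=
             2 * #|` cells| * (if is_rm A then 0 else size (frames s)).
  elim: (frames s) fs => [|f l IH] /=; first by rewrite big_nil.
  case/andP => /andP[_ fok] /IH; rewrite big_cons /frame_size.
  case: (fcopy f) fok => [[fpc fac] /and3P[/negbTE -> fpcP facP] lel|_ lel].
    by rewrite mulnS leq_add // mul2n -addnn leq_add // fsubset_leq_card.
  by apply: leq_trans lel _; rewrite leq_mul2l; case: is_rm; rewrite ?leqnSn orbT.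
apply: leq_trans (leq_add live saved) _.
by case: is_rm; rewrite -mulnS.
Qed.

Lemma inv_touch k s : inv k s -> inv k (touch s).
Proof.
move=> invs; have := space_le invs; case/andP: invs => st pk sp.
by rewrite /inv geq_max pk sp; apply/andP; split.
Qed.

(** * Writes to the structures and updates of the domains *)

Lemma sub_cells_setf (m : store P) (i : var) (a : val) (j : var) p :
  con i j -> mem0 i a -> domf m `<=` cells ->
  domf (m.[(i, a, j) <- p])%fmap `<=` cells.
Proof.
move=> cij ai sub; rewrite dom_setf fsubUset sub andbT fsub1set !inE.
exact: mem_addresses.
Qed.

Lemma inv_setPC k i a j b s :
  con i j -> mem0 i a -> inv k s -> inv k (setPC i a j b s).
Proof.
move=> cij ai /andP[/and5P[? ? ? ? ?] ?]; apply: inv_touch.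
by apply/andP; split => //; apply/and5P; split => //; exact: sub_cells_setf.
Qed.

Lemma inv_setAC k i a j b s :
  con i j -> mem0 i a -> inv k s -> inv k (setAC i a j b s).
Proof.
move=> cij ai /andP[/and5P[? ? ? ? ?] ?]; apply: inv_touch.
by apply/andP; split => //; apply/and5P; split => //; exact: sub_cells_setf.
Qed.

Lemma inv_set_dom k i D s :
  {subset D <= dom0 i} -> inv k s -> inv k (set_dom i D s).
Proof.
move=> sD /andP[/and5P[/forallP dok ? ? ? ?] ?].
apply/andP; split => //; apply/and5P; split => //.
apply/forallP => l; rewrite ffunE; case: eqP => [->|_]; last exact: dok.
exact/allP.
Qed.

Lemma inv_delete k i a s : inv k s -> inv k (delete i a s).
Proof.
move=> invs; apply: inv_set_dom => // b; rewrite mem_filter => /andP[_].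
exact: inv_dom invs b.
Qed.

(** * Invariant rules for loops, valid also on early exit *)

Lemma allM_ind (S : Type) (T : eqType) (I : S -> Prop)
    (f : T -> S -> bool * S) l s :
  (forall x s, x \in l -> I s -> I (f x s).2) -> I s -> I (allM f l s).2.
Proof.
elim: l s => //= x l IH s If Is; have := If x s (mem_head _ _) Is.
case: (f x s) => [[] s'] //= Is'; apply: IH => // y t yl.
by apply: If; rewrite inE yl orbT.
Qed.

Lemma hasM_ind (S : Type) (T : eqType) (I : S -> Prop)
    (f : T -> S -> bool * S) l s :
  (forall x s, x \in l -> I s -> I (f x s).2) -> I s -> I (hasM f l s).2.
Proof.
elim: l s => //= x l IH s If Is; have := If x s (mem_head _ _) Is.
case: (f x s) => [[] s'] //= Is'; apply: IH => // y t yl.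
by apply: If; rewrite inE yl orbT.
Qed.

Lemma foldl_ind (S : Type) (T : eqType) (I : S -> Prop) (f : S -> T -> S) l s :
  (forall x s, x \in l -> I s -> I (f s x)) -> I s -> I (foldl f s l).
Proof.
elim: l s => //= x l IH s If Is; apply: IH; last by apply: If; rewrite ?mem_head.
by move=> y t yl; apply: If; rewrite inE yl orbT.
Qed.

(** * Preservation by the propagation procedures *)

Lemma inv_seekACsupport k i a l s :
  con i l -> mem0 i a -> inv k s -> inv k (seekACsupport i a l s).2.
Proof.
by move=> cil ai invs; rewrite /seekACsupport; case: filter => //= b _;
  exact: inv_setAC.
Qed.

Lemma inv_witness_in k i a j b l s :
  con i l -> con j l -> mem0 i a -> mem0 j b -> inv k s ->
  inv k (witness_in A i a j b l s).2.
Proof.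
move=> cil cjl ai bj invs; rewrite /witness_in; case: (_ || _) => //.
case: ifP => rmA.
  by case: filter => //= w _; do 2!apply: inv_setAC => //.
have := inv_seekACsupport cil ai invs.
case: (seekACsupport i a l s) => [[] si] //= invi.
have := inv_seekACsupport cjl bj invi.
by case: (seekACsupport j b l si) => [[] sj] //= invj; case: filter.
Qed.

Lemma inv_searchPCwit k i a j b s :
  mem0 i a -> mem0 j b -> inv k s -> inv k (searchPCwit A i a j b s).2.
Proof.
move=> ai bj; apply: (allM_ind (I := inv k)) => l t.
by rewrite mem_filter => /andP[/andP[? ?] _]; exact: inv_witness_in.
Qed.

(** The residue versions also write the mirrored pointer at [(j, b, i)]; this address is a cell
    because [b] is an initial value of [j] and constraints are symmetric. *)
Lemma inv_try_value k init i a j b s :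
  con i j -> mem0 i a -> mem0 j b -> inv k s ->
  inv k (try_value A init i a j b s).2.
Proof.
move=> cij ai bj invs; rewrite /try_value; case: allows => //=.
set t := if _ then setAC _ _ _ _ _ else s.
have invt : inv k t by rewrite /t; case: ifP => // _; exact: inv_setAC.
have := inv_searchPCwit ai bj invt.
case: searchPCwit => [[] s1] //= inv1.
have inv2 := inv_setPC b cij ai inv1.
by case: ifP => // _; apply: inv_setPC; rewrite 1?con_sym //; exact: inv_setAC.
Qed.

Lemma inv_search_phase k i a j s :
  con i j -> mem0 i a -> inv k s -> inv k (search_phase A i a j s).2.
Proof.
move=> cij ai invs; apply: (hasM_ind (I := inv k)) => // b t.
(* The list of candidates is fixed on entry, so the invariant of the entry state [s] places [b] in
   the initial domain. *)
rewrite mem_filter => /andP[_ /(inv_dom invs) bj]; exact: inv_try_value.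
Qed.

Lemma inv_searchPCsup k i a j s :
  con i j -> mem0 i a -> inv k s -> inv k (searchPCsup A i a j s).2.
Proof.
by move=> cij ai invs; rewrite /searchPCsup; case: ifP => // _;
  exact: inv_search_phase.
Qed.

Lemma inv_checkPCwit k i a j s :
  con i j -> mem0 i a -> inv k s -> inv k (checkPCwit A i a j s).2.
Proof.
move=> cij ai; apply: (allM_ind (I := inv k)) => l t.
rewrite mem_filter => /andP[/andP[cil clj] _] invt.
set r := (X in let: (_, _) := X in _).
have: inv k r.2.
  (* The invariant does not constrain the values of pointers; that [c] is an initial value comes
     from the test against the current domain. *)
  rewrite /r; case: getPC => // c; case: ifP => // /(inv_dom invt) cl.
  exact: inv_witness_in.
by case: r => [[] s1] //=; exact: inv_search_phase.
Qed.

Lemma inv_revise k j i Ls a :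
  con i j -> mem0 i a -> inv k Ls.2 -> inv k (revise A j i Ls a).2.
Proof.
case: Ls => L s /= cij ai invs.
have := inv_searchPCsup cij ai invs.
case: searchPCsup => ok s1 /= inv1.
set r := (X in let: (_, _) := X in _).
have: inv k r.2 by rewrite /r; case: ifP => // _; exact: inv_checkPCwit.
by case: r => [[] s2] //= inv2; exact: inv_delete.
Qed.

Lemma inv_process k j L s : inv k s -> inv k (process A j L s).2.2.
Proof.
move=> invs; apply: (allM_ind (I := fun Ls => inv k Ls.2)) => // i Ls.
rewrite mem_filter => /andP[cij _] {}invs /=.
apply: (foldl_ind (I := fun Ls => inv k Ls.2)) => // a t /(inv_dom invs).
exact: inv_revise.
Qed.

Lemma inv_init_value k i Ls a :
  mem0 i a -> inv k Ls.2 -> inv k (init_value A i Ls a).2.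
Proof.
case: Ls => L s /= ai invs.
set r := (X in let: (_, _) := X in _).
have: inv k r.2.
  apply: (allM_ind (I := inv k)) => // j t.
  rewrite mem_filter => /andP[cij _] invt.
  apply: (hasM_ind (I := inv k)) => // b u /(inv_dom invt).
  exact: inv_try_value.
by case: r => [[] s1] //= inv1; exact: inv_delete.
Qed.

Lemma inv_initialization k s : inv k s -> inv k (initialization A s).2.2.
Proof.
move=> invs; apply: (allM_ind (I := fun Ls => inv k Ls.2)) => // i Ls _ {}invs /=.
apply: (foldl_ind (I := fun Ls => inv k Ls.2)) => // a t /(inv_dom invs).
exact: inv_init_value.
Qed.

Lemma inv_loop k L s o s' : loop A L s o s' -> inv k s -> inv k s'.
Proof.
elim=> {L s o s'} // [L s j L' s' _ E|L s j L' s' o s'' _ E _ IH] invs.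
  by have := inv_process j (L :\ j)%SET invs; rewrite E.
by apply: IH; have := inv_process j (L :\ j)%SET invs; rewrite E.
Qed.

(** * Invocations and backtracking search *)

Lemma inv_invoke k s v o s' :
  (if v is Assign x a then a \in dom s x else true) ->
  invoke A s v o s' -> inv k s -> inv k s'.
Proof.
move=> vP inv_s; case: inv_s vP => {v o s'}
  [L s' E _|L s' o s'' E lp _|x a o s' lp ax] invs.
- by have := inv_initialization invs; rewrite E.
- by apply: (inv_loop lp); have := inv_initialization invs; rewrite E.
- apply: (inv_loop lp); apply: inv_set_dom => // b.
  by rewrite inE => /eqP ->; exact: inv_dom invs a ax.
Qed.

Lemma inv_enter k X s : inv k s -> inv k.+1 (enter A X s).
Proof.
case/andP => /and5P[D ? ? ? ?] pk; apply: inv_touch; apply/andP; split.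
  apply/and5P; split => //=; apply/andP; split => //.
  by rewrite /frame_sound D /=; case: ifP => //= _; apply/andP.
exact: leq_trans pk (leq_capacity (leqnSn k)).
Qed.

(** Only success adds a frame; the other outcomes keep the index [k] and are weakened. *)
Lemma inv_forward k s v o s' : forward A s v o s' -> inv k s -> inv k.+1 s'.
Proof.
case=> {v o s'} [o s' _ /inv_invoke|f fs x a o s' _ _ ax /inv_invoke] inv' invs.
  have {}inv' := inv' k isT invs.
  by case: o => //; [exact: invW inv'|exact: inv_enter|exact: invW inv'].
have {}inv' := inv' k ax invs.
by case: o => //; [exact: invW inv'|exact: inv_enter|exact: invW inv'].
Qed.

Lemma inv_initial : inv 0 (initial P).
Proof.
apply/andP; split.
  rewrite /= !fsubset_refl andbT.
  by apply/forallP => i; apply/allP => a; rewrite ffunE.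
rewrite /= /space /= big_nil addn0 /store_size /= addnn -mul2n.
by rewrite leq_pmulr //; case: is_rm.
Qed.

Lemma inv_restore k s : inv k s -> inv k (restore s).
Proof.
rewrite /restore; case E: (frames s) => [//|f fs].
case/andP => /and5P[_ pc ac]; rewrite E => fsok sz pk.
have /andP[/andP[fD fcp] _] := fsok.
case: (fcopy f) fcp => [[fpc fac]|] fcp.
  case/and3P: fcp => _ fpcP facP.
  by apply/andP; split => //; apply/and5P.
by apply/andP; split => //; apply/and5P.
Qed.

Lemma inv_pop k s : inv k s -> inv k (pop s).
Proof.
case/andP => /and5P[D pc ac fsok sz] pk; apply/andP; split => //.
apply/and5P; split => //=; first by case: (frames s) fsok => //= f fs /andP[].
by rewrite size_behead; exact: leq_trans (leq_pred _) sz.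
Qed.

(** The index stays existential: here it grows with every forward move, even one that is undone.
    Measurements start after a reset of the peak, where the index is chosen afresh. *)
Lemma inv_search s : search A s -> exists k, inv k s.
Proof.
elim=> {s} [||s v s' _ [k invs] fw|s x a s' _ [k invs] fw|s _ [k invs] _].
- by exists 0; exact: inv_initial.
- by exists 1; apply: inv_enter; exact: inv_initial.
- by exists k.+1; exact: inv_forward fw invs.
- by exists k.+1; apply: inv_restore; exact: inv_forward fw invs.
- by exists k; apply: inv_restore; exact: inv_pop.
Qed.

(** * Peaks of one invocation and of one branch *)

Lemma inv_reset_peak k l s :
  inv k s -> size (frames s) <= l -> inv l (reset_peak s).
Proof.
case/andP => /and5P[D pc ac fsok _] _ szl.
(* With peak 0 the bound on the peak is trivial, so [space_le] applies at index [l] and bounds the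
   new peak. *)
have inv0 : inv l (State (dom s) (lastPC s) (lastAC s) (frames s) 0).
  by apply/andP; split => //; apply/and5P; split.
have sp := space_le inv0; case/andP: inv0 => st _.
by apply/andP; split.
Qed.

Lemma inv_node_state k s : inv k s -> inv 1 (node_state s).
Proof.
case/andP => /and5P[D pc ac fsok sz] pk.
apply: (@inv_reset_peak k) => /=; last by rewrite size_take_min geq_minl.
apply/andP; split => //; apply/and5P; split => //=.
  by case: (frames s) fsok => //= f fs /andP[-> _]; rewrite take0.
by rewrite size_take_min (leq_trans (geq_minr _ _) sz).
Qed.

Lemma inv_branch l k s s' : branch A k s s' -> inv l s -> inv (l + k) s'.
Proof.
move=> br; elim: br l => {k s s'} [s|s v o s' fw|s v s' k s'' fw _ IH] l invs.
- by rewrite addn0.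
- by rewrite addn1; exact: inv_forward fw invs.
- by rewrite addnS -addSn; apply: IH; exact: inv_forward fw invs.
Qed.

(** Two frames: the one kept by [node_state] and the one entered on success. *)
Lemma node_space_le m : node_space P A m -> m <= capacity 2.
Proof.
case=> s [v [o [s' [/inv_search[k /inv_node_state invs] fw ->]]]].
by case/andP: (inv_forward fw invs).
Qed.

(** At most one frame at the root and one more for each of at most n invocations. *)
Lemma branch_space_le m : branch_space P A m -> m <= capacity (nvar P).+1.
Proof.
case=> s [k [s' [/inv_search[l invs] sz kn br ->]]].
have := inv_branch br (inv_reset_peak invs sz).
by case/(invW (_ : 1 + k <= (nvar P).+1))/andP.
Qed.

End SpaceInvariant.

(** * Asymptotic bounds *)

Lemma node_space_O A : space_O (fun P => node_space P A) (fun n e d => e * d).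
Proof.
exists 24 => n e d P _ <- <- m /node_space_le /leq_trans; apply.
(* Two structures, at most 4ed cells in each, and at most three pairs: the live one and two
   copies. *)
rewrite (_ : 24 = 2 * 4 * 3) // mulnAC; apply: leq_mul; last by case: is_rm.
by rewrite -mulnA leq_mul2l card_cells.
Qed.

Lemma rm_branch_space_O A :
  is_rm A -> space_O (fun P => branch_space P A) (fun n e d => e * d).
Proof.
move=> rmA; exists 8 => n e d P _ <- <- m /branch_space_le /leq_trans; apply.
rewrite /capacity rmA muln1 (_ : 8 = 2 * 4) // -mulnA leq_mul2l.
exact: card_cells.
Qed.

Lemma branch_space_O A :
  space_O (fun P => branch_space P A) (fun n e d => e * n * d).
Proof.
exists 24 => n e d P <- <- <- m /branch_space_le /leq_trans; apply.
have leC := card_cells P.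
(* Without constraints there are no cells and both sides vanish; otherwise n is at least 2, so the n
   + 2 pairs number at most 3n. *)
have [e0|/ncon_gt0_nvar n1] := posnP (ncon P).
  by move: leC; rewrite /capacity e0 leqn0 => /eqP ->.
have le3 : (if is_rm A then 1 else (nvar P).+2) <= 3 * nvar P.
  apply: leq_trans (_ : (nvar P).+2 <= _); first by case: is_rm.
  by rewrite mulSnr addnC -addn2 leq_add // (leq_trans n1) // leq_pmull.
apply: leq_trans (leq_mul (leq_mul (leqnn 2) leC) le3) _.
by rewrite !mulnA -[2 * 4]/8 (mulnAC _ _ 3) (mulnAC _ _ 3) -[8 * 3]/24 mulnAC.
Qed.

Theorem mainTheorem5 :
  [/\ space_O (fun P => node_space P maxRPC3) (fun n e d => e * d),
      space_O (fun P => node_space P lmaxRPC3) (fun n e d => e * d),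
      space_O (fun P => node_space P maxRPC3rm) (fun n e d => e * d) &
      space_O (fun P => node_space P lmaxRPC3rm) (fun n e d => e * d)]
  /\
  [/\ space_O (fun P => branch_space P maxRPC3) (fun n e d => e * n * d),
      space_O (fun P => branch_space P lmaxRPC3) (fun n e d => e * n * d),
      space_O (fun P => branch_space P maxRPC3rm) (fun n e d => e * d) &
      space_O (fun P => branch_space P lmaxRPC3rm) (fun n e d => e * d)].
Proof.
split; split; try exact: node_space_O; try exact: branch_space_O;
  exact: rm_branch_space_O.
Qed.
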